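(* Let $k\geqslant 2$ be an integer. For every integer $n\geqslant 3$ with $n\geqslant k$, the star graph $S_n$ on $n$ vertices satisfies $$\gamma_{k\text{-SRD}}(S_n)=\begin{cases}k+1, & \text{if } n>k,\\ n, & \text{if } n=k.\end{cases}$$ Likewise, for every integer $n\geqslant 4$ with $n\geqslant k$, the wheel graph $W_n$ on $n$ vertices satisfies $\gamma_{k\text{-SRD}}(W_n)=k+1$ if $n>k$, and $\gamma_{k\text{-SRD}}(W_n)=n$ if $n=k$.
   Context: $S_n$ has vertex set $\{a_1,\ldots,a_n\}$ and edge set $\{a_1a_i : i\in\{2,\ldots,n\}\}$. $W_n$ has vertex set $\{a_1,\ldots,a_n\}$ and edge set $\{a_1a_i : i\in\{2,\ldots,n\}\}\cup\{a_ia_{i+1} : i\in\{2,\ldots,n-1\}\}\cup\{a_na_2\}$. All graphs are finite, simple and undirected; $N(v)$ denotes the set of neighbors of $v$ and $\Delta(G)$ the maximum degree. Let $k\geqslant 1$ be an integer with $|V(G)|\geqslant k$. An attack pattern is a set $P\subseteq V(G)$ with $|P|=k$. A function $f:V(G)\to\{0,1,\ldots,\min(\Delta(G),k)+1\}$ is a proper $k$-SRD ($k$-strong Roman domination) function if for each attack pattern $P$ every vertex $u\in P$ with $f(u)=0$ can be defended by a neighboring vertex, where each vertex $v$ with $f(v)\geqslant 2$ can defend at most $f(v)-1$ of its neighbors in $P$ labeled 0 (and vertices with label $\leqslant 1$ defend no other vertex). That is, for each $P$ there is a map $\delta_P:\{u\in P : f(u)=0\}\to V(G)$ (which may depend on $P$)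 such that $\delta_P(u)\in N(u)$ and $f(\delta_P(u))\geqslant 2$ for all $u$ in its domain, and $|\delta_P^{-1}(v)|\leqslant f(v)-1$ for every $v$ with $f(v)\geqslant 2$. The weight is $\omega(f)=\sum_{v\in V(G)}f(v)$, and the $k$-SRD number is $\gamma_{k\text{-SRD}}(G)=\min\{\omega(f) : f \text{ is a proper } k\text{-SRD function on } G\}$. *)

(* Defs.v *)
From mathcomp Require Import all_boot.

Set Implicit Arguments.
Unset Strict Implicit.
Unset Printing Implicit Defensive.

Record sgraph := SGraph {
  vertex :> finType;
  edge : rel vertex;
  edge_sym : symmetric edge;
  edge_irrefl : irreflexive edge }.

Definition neighbors (G : sgraph) (v : G) : {set G} := [set u | edge v u].

Definition max_degree (G : sgraph) : nat := \max_(v : G) #|neighbors v|.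

Section StrongRomanDomination.

Variables (k : nat) (G : sgraph).

(* The possible labels are 0, 1, ..., min(Delta(G), k) + 1. *)
Definition labeling := {ffun G -> 'I_(minn (max_degree G) k).+2}.

Definition weight (f : labeling) : nat := \sum_(v : G) f v.

(* d assigns a defender to every attacked vertex labeled 0. *)
Definition defends (f : labeling) (P : {set G})
    (d : {ffun {u : G | (u \in P) && (f u == 0 :> nat)} -> G}) : bool :=
  [forall u, (d u \in neighbors (val u)) && (2 <= f (d u))] &&
  [forall v : G, (2 <= f v) ==> (#|[set u | d u == v]| <= f v - 1)].

Definition proper_kSRD (f : labeling) : bool :=
  [forall P : {set G}, (#|P| == k) ==> [exists d, @defends f P d]].

Definition ones : labeling := [ffun=> Ordinal (isT : 1 < _.+2)].

Lemma ones_proper : proper_kSRD ones.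
Proof.
apply/forallP => P; apply/implyP => _.
have noz (u : {u : G | (u \in P) && (ones u == 0 :> nat)}) : False.
  by case: u => u /=; rewrite ffunE andbF.
apply/existsP; exists [ffun u => val u]; apply/andP; split.
  by apply/forallP => u; case: (noz u).
by apply/forallP => v; rewrite ffunE.
Qed.

Lemma proper_weight_ex :
  exists w, [exists f : labeling, proper_kSRD f && (weight f == w)].
Proof.
by exists (weight ones); apply/existsP; exists ones; rewrite ones_proper eqxx.
Qed.

Definition kSRD_number : nat := ex_minn proper_weight_ex.

End StrongRomanDomination.

Section SymmetricClosure.

Variables (T : finType) (r : rel T).

Definition sym_edge : rel T := [rel x y | (x != y) && (r x y || r y x)].

Lemma sym_edge_sym : symmetric sym_edge.
Proof. by move=> x y; rewrite /sym_edge /= eq_sym orbC. Qed.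

Lemma sym_edge_irrefl : irreflexive sym_edge.
Proof. by move=> x; rewrite /sym_edge /= eqxx. Qed.

Definition sgraph_of : sgraph := SGraph sym_edge_sym sym_edge_irrefl.

End SymmetricClosure.

(* The ordinal i : 'I_n stands for the vertex a_(i+1), so the centre is 0 and
   the remaining vertices are 1, ..., n-1. *)
Definition spoke (n : nat) : rel 'I_n :=
  [rel i j : 'I_n | (i == 0 :> nat) && (1 <= j)].

Definition rim (n : nat) : rel 'I_n :=
  [rel i j : 'I_n | (1 <= i) && (j == i.+1 :> nat)
                    || (i == n.-1 :> nat) && (j == 1 :> nat)].

Definition star (n : nat) : sgraph := sgraph_of (@spoke n).

Definition wheel (n : nat) : sgraph :=
  sgraph_of [rel i j : 'I_n | spoke i j || rim i j].

(* Main.v *)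
(** The formula holds in every graph [G] with a vertex adjacent to all others.
    Let [f] be proper with [z] vertices labeled 0. A vertex labeled [l] defends
    at most [l - 1] vertices, so [min(k, z) <= \sum_v (f v - 1)], as some attack
    meets the zero set in [min(k, z)] vertices; the weight exceeds this sum by
    the number [#|G| - z] of positive labels. Hence the weight is at least
    [k + 1] if [k <= z], and at least [#|G|] otherwise. For [k < #|G|] the
    bound is attained by the label [k + 1] on the universal vertex and 0
    elsewhere, and for [k = #|G|] by the all-ones labeling. *)
Require Import Defs.
From mathcomp Require Import all_boot.

Set Implicit Arguments.
Unset Strict Implicit.
Unset Printing Implicit Defensive.

Lemma subset_of_card (T : finType) (A : {set T}) (m : nat) :
  m <= #|A| -> exists2 B : {set T}, B \subset A & #|B| = m.
Proof.
move/card_geqP => [s [s_uniq <- sA]].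
exists [set x in s]; first by apply/subsetP => x; rewrite inE; apply: sA.
by rewrite cardsE; apply/card_uniqP.
Qed.

(** An attack has exactly [k] elements, so when [A] is smaller than [k] it is padded with points of
    its complement. *)
Lemma set_card_meet_min (T : finType) (A : {set T}) (k : nat) :
  k <= #|T| -> exists2 P : {set T}, #|P| = k & #|P :&: A| = minn k #|A|.
Proof.
move=> le_kT; have [le_kA|lt_Ak] := leqP k #|A|.
  have [P sPA <-] := subset_of_card le_kA.
  by exists P => //; rewrite (setIidPl sPA).
have [B sBA cardB] : exists2 B : {set T}, B \subset ~: A & #|B| = k - #|A|.
  by apply: subset_of_card; rewrite [X in _ <= X]cardsCs setCK leq_sub2r.
have disAB : A :&: B = set0.
  by apply/eqP; rewrite setI_eq0 disjoint_sym disjoints_subset.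
exists (A :|: B); last by rewrite setIC (setIidPl (subsetUl _ _)).
by rewrite cardsU disAB cards0 subn0 cardB subnKC // ltnW.
Qed.

Section LowerBound.

Variables (k : nat) (G : sgraph) (f : labeling k G).

Let zeros : {set G} := [set v | f v == 0 :> nat].

(** Pointwise, [f v] is [f v - 1] plus 1 if [v] is not in [zeros]; truncated subtraction makes both
    terms vanish at label 0. *)
Lemma weight_excess :
  weight f = \sum_(v : G) (f v - 1) + (#|G| - #|zeros|).
Proof.
rewrite /weight -cardsT -cardsDS ?subsetT // -sum1_card.
rewrite [X in _ = _ + X]big_mkcond -big_split /=; apply: eq_bigr => v _.
by rewrite !inE andbT; case: (nat_of_ord (f v)) => // m; rewrite subn1 addn1.
Qed.

(** The fibres of [d] partition the attacked zeros. The fibre over [v] has at most [f v - 1]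
    elements, and it is empty when [f v < 2]. *)
Lemma defends_capacity (P : {set G}) d :
  @defends k G f P d -> #|P :&: zeros| <= \sum_(v : G) (f v - 1).
Proof.
case/andP => /forallP d_ok /forallP d_cap.
have -> : #|P :&: zeros| = #|{: {u : G | (u \in P) && (f u == 0 :> nat)}}|.
  by rewrite card_sig; apply: eq_card => u; rewrite !inE.
rewrite -sum1_card (partition_big d predT) //=; apply: leq_sum => v _.
rewrite sum1dep_card.
have [f_ge2|f_lt2] := boolP (2 <= f v); first exact: (implyP (d_cap v)).
rewrite eq_card0 // => u; rewrite !inE; apply: contraNF f_lt2 => /eqP <-.
by case/andP: (d_ok u).
Qed.

Lemma proper_weight_ge :
  0 < k <= #|G| -> proper_kSRD f -> minn k.+1 #|G| <= weight f.
Proof.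
case/andP => k_gt0 le_kG f_proper.
have [P cardP capP] := set_card_meet_min zeros le_kG.
have /existsP [d /defends_capacity] := implyP (forallP f_proper P) (introT eqP cardP).
rewrite capP weight_excess.
have le_zG : #|zeros| <= #|G| := max_card _.
set s := \sum_(v : G) _ => le_s.
have [le_kz|lt_zk] := leqP k #|zeros|; last first.
  rewrite (minn_idPr (ltnW lt_zk)) in le_s.
  by rewrite geq_min orbC -[X in X <= _ + _](subnKC le_zG) leq_add2r le_s.
rewrite (minn_idPl le_kz) in le_s.
rewrite geq_min -addn1 leq_add // subn_gt0 ltn_neqAle le_zG andbT.
(* Some label is positive: if all were 0, the sum [s] would be 0, against [0 < k <= s]. *)
apply: contraTN (leq_trans k_gt0 le_s) => /eqP eq_zG.
have zerosT : zeros = setT by apply/eqP; rewrite eqEcard subsetT cardsT eq_zG leqnn.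
rewrite -eqn0Ngt; apply/eqP; apply: big1 => v _.
have : v \in zeros by rewrite zerosT inE.
by rewrite inE => /eqP ->.
Qed.

End LowerBound.

Section UniversalVertex.

Variables (k : nat) (G : sgraph) (c : G).
Hypothesis c_universal : forall v, v != c -> edge c v.
Hypothesis lt_kG : k < #|G|.

(** Ensures that the label [k + 1] is in range: [c] has [#|G| - 1 >= k] neighbors. *)
Lemma universal_max_degree : k <= max_degree G.
Proof.
apply: leq_trans (leq_bigmax c).
have : #|~: [set c]| <= #|neighbors c|.
  by apply/subset_leq_card/subsetP => v; rewrite !inE; apply: c_universal.
by apply: leq_trans; rewrite cardsC1 -ltnS prednK // (leq_ltn_trans _ lt_kG).
Qed.

Lemma universal_label_bound : k.+1 < (minn (max_degree G) k).+2.
Proof. by rewrite (minn_idPr universal_max_degree). Qed.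

Definition universal_labeling : labeling k G :=
  [ffun v => if v == c then Ordinal universal_label_bound else ord0].

Lemma universal_labeling_weight : weight universal_labeling = k.+1.
Proof.
rewrite /weight (bigD1 c) //= ffunE eqxx big1 ?addn0 // => v /negPf vc.
by rewrite ffunE vc.
Qed.

Lemma universal_labeling_proper : 0 < k -> proper_kSRD universal_labeling.
Proof.
move=> k_gt0; apply/forallP => P; apply/implyP => /eqP cardP.
apply/existsP; exists [ffun=> c]; apply/andP; split; apply/forallP.
  move=> [u /= u_def]; rewrite !ffunE eqxx /= ltnS k_gt0 andbT inE.
  rewrite edge_sym; case/andP: u_def => _.
  by rewrite ffunE; have [->|/c_universal] := eqVneq u c.
move=> v; apply/implyP; rewrite ffunE; case: eqP => //= _ _.
(* The capacity of [c] is [k], the size of the whole attack. *)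
rewrite subn1 /= -[X in _ <= X]cardP; apply: leq_trans (max_card _) _.
by rewrite card_sig; apply/subset_leq_card/subsetP => u; rewrite inE => /andP[].
Qed.

End UniversalVertex.

Lemma kSRD_number_le (k : nat) (G : sgraph) (f : labeling k G) :
  proper_kSRD f -> kSRD_number k G <= weight f.
Proof.
move=> f_proper; rewrite /kSRD_number; case: ex_minnP => w _; apply.
by apply/existsP; exists f; rewrite f_proper eqxx.
Qed.

Lemma kSRD_number_ge (k : nat) (G : sgraph) :
  0 < k <= #|G| -> minn k.+1 #|G| <= kSRD_number k G.
Proof.
move=> k_bounds; rewrite /kSRD_number; case: ex_minnP => w /existsP[f].
by case/andP=> f_proper /eqP <- _; apply: proper_weight_ge.
Qed.

Lemma ones_weight (k : nat) (G : sgraph) : weight (ones k G) = #|G|.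
Proof. by rewrite -sum1_card; apply: eq_bigr => v _; rewrite ffunE. Qed.

Lemma kSRD_number_universal (k : nat) (G : sgraph) (c : G) :
  (forall v, v != c -> edge c v) -> 0 < k <= #|G| ->
  kSRD_number k G = minn k.+1 #|G|.
Proof.
move=> c_univ k_bounds; apply/eqP; rewrite eqn_leq kSRD_number_ge // andbT.
rewrite leq_min -[X in _ && (_ <= X)](ones_weight k G) (kSRD_number_le (ones_proper k G)) andbT.
have [k_gt0 le_kG] := andP k_bounds; have [lt_kG|le_Gk] := ltnP k #|G|.
  rewrite -(universal_labeling_weight c_univ lt_kG).
  exact/kSRD_number_le/universal_labeling_proper.
(* For [#|G| <= k] the label [k + 1] is out of range, but the all-ones labeling already has weight
   below [k + 1]. *)
apply: leq_trans (kSRD_number_le (ones_proper k G)) _.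
by rewrite ones_weight (leq_trans le_Gk).
Qed.

(** Treats stars and wheels at once: as soon as [r] contains the spokes, the vertex 0 is
    universal. *)
Lemma spoke_kSRD_number (k n : nat) (r : rel 'I_n) :
  0 < k <= n -> subrel (@spoke n) r ->
  kSRD_number k (sgraph_of r) = if k < n then k + 1 else n.
Proof.
case: n r => [|n] r /andP[k_gt0 le_kn] spoke_r.
  by rewrite leqn0 in le_kn; rewrite (eqP le_kn) in k_gt0.
rewrite (@kSRD_number_universal k (sgraph_of r) (ord0 : 'I_n.+1)).
- rewrite /= card_ord addn1; case: ltnP => [lt_kn|le_nk].
    exact/minn_idPl.
  exact/minn_idPr/leqW.
- move=> v v0; rewrite /= /sym_edge /= eq_sym v0 /=; apply/orP; left; apply: spoke_r.
  by rewrite /spoke /= lt0n.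
- by rewrite /= card_ord k_gt0.
Qed.

Theorem proposition7 (k : nat) (hk : 2 <= k) :
  (forall n : nat, 3 <= n -> k <= n ->
     kSRD_number k (star n) = if k < n then k + 1 else n) /\
  (forall n : nat, 4 <= n -> k <= n ->
     kSRD_number k (wheel n) = if k < n then k + 1 else n).
Proof.
split=> n _ le_kn; apply: spoke_kSRD_number; rewrite ?(ltnW hk) //.
by move=> i j /= ->.
Qed.
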